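(* The quantized actions and the shifting operators satisfy the commutation relations $$[\mathbf{Q}_{A_j},\mathbf{Q}_{A_k}]=[\mathbf{a}_j,\mathbf{a}_k]=0,\qquad [\mathbf{Q}_{A_j},\mathbf{a}_k]=-\hbar\,\mathbf{a}_j\,\delta_{jk},$$ for $j,k=1,2$.
   Context: Let $\mathfrak{H}$ be a complex Hilbert space with orthonormal basis (the Bohr-Sommerfeld basis of the quantum spherical pendulum) $\mathfrak{B}=\{\sigma_{n,m} : (n,m)\in\mathbb{Z}^2,\ n\ge0\}$, and let $\hbar>0$. The quantized actions $\mathbf{Q}_{A_1},\mathbf{Q}_{A_2}$ are the operators diagonal in this basis given by $\mathbf{Q}_{A_1}\sigma_{n,m}=n\hbar\,\sigma_{n,m}$ and $\mathbf{Q}_{A_2}\sigma_{n,m}=m\hbar\,\sigma_{n,m}$. The shifting operators $\mathbf{a}_1,\mathbf{a}_2$ are given by $\mathbf{a}_1\sigma_{n,m}=\sigma_{n-1,m}$ for $n>0$, $\mathbf{a}_1\sigma_{0,m}=0$, and $\mathbf{a}_2\sigma_{n,m}=\sigma_{n,m-1}$. The relations are understood on basis vectors, hence on the (dense) linear span of $\mathfrak{B}$. *)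

(* Defs.v *)
From HB Require Import structures.
From mathcomp Require Import all_boot all_order all_algebra.
From mathcomp Require Import all_classical all_reals all_analysis.
From mathcomp Require Export complex.

Set Implicit Arguments.
Unset Strict Implicit.
Unset Printing Implicit Defensive.

Import Order.TTheory GRing.Theory Num.Theory.
Import numFieldNormedType.Exports.

Local Open Scope classical_set_scope.
Local Open Scope ring_scope.
Local Open Scope complex_scope.

Section Subspaces.
Variables (K : pzRingType) (H : lmodType K).

Definition linear_subspace (D : set H) : Prop :=
  D 0 /\ forall (c : K) (x y : H), D x -> D y -> D (c *: x + y).

(* The algebraic span: no closure is taken. *)
Definition linear_span (A : set H) : set H := smallest linear_subspace A.

End Subspaces.

(* A possibly unbounded linear operator on H: only the values of op_fun on
   op_dom are meaningful, and op_dom need be neither dense nor closed. *)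
Record operator (K : comPzRingType) (H : lmodType K) := Operator {
  op_dom : set H;
  op_fun :> H -> H;
  op_dom_subspace : linear_subspace op_dom;
  op_linear : forall (c : K) (x y : H), op_dom x -> op_dom y ->
    op_fun (c *: x + y) = c *: op_fun x + op_fun y
}.

Section Operators.
Variables (K : comPzRingType) (H : lmodType K).
Implicit Types A B : operator H.

Lemma op0 A : A 0 = 0.
Proof.
have [A0 _] := op_dom_subspace A.
have := op_linear (-1) A0 A0.
by rewrite scaler0 addr0 scaleN1r addNr.
Qed.

Definition comp_dom A B : set H := [set x | op_dom B x /\ op_dom A (B x)].

Lemma comp_dom_subspace A B : linear_subspace (comp_dom A B).
Proof.
have [A0 AD] := op_dom_subspace A; have [B0 BD] := op_dom_subspace B.
split=> [|c x y [Bx ABx] [By ABy]]; rewrite /comp_dom /=.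
  by rewrite op0.
by rewrite op_linear //; split; [exact: BD | exact: AD].
Qed.

Lemma comp_linear A B (c : K) (x y : H) : comp_dom A B x -> comp_dom A B y ->
  A (B (c *: x + y)) = c *: A (B x) + A (B y).
Proof. by move=> [Bx ABx] [By ABy]; rewrite !op_linear. Qed.

Definition op_comp A B : operator H :=
  Operator (comp_dom_subspace A B) (@comp_linear A B).

Lemma sub_dom_subspace A B : linear_subspace (op_dom A `&` op_dom B).
Proof.
have [A0 AD] := op_dom_subspace A; have [B0 BD] := op_dom_subspace B.
split=> // c x y [Ax Bx] [Ay By].
by split; [exact: AD | exact: BD].
Qed.

Lemma sub_linear A B (c : K) (x y : H) :
  (op_dom A `&` op_dom B) x -> (op_dom A `&` op_dom B) y ->
  A (c *: x + y) - B (c *: x + y) = c *: (A x - B x) + (A y - B y).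
Proof.
by move=> [Ax Bx] [Ay By]; rewrite !op_linear // opprD addrACA -scalerBr.
Qed.

Definition op_sub A B : operator H :=
  Operator (op_fun := fun x => A x - B x)
    (sub_dom_subspace A B) (@sub_linear A B).

Lemma scale_linear (a : K) A (c : K) (x y : H) : op_dom A x -> op_dom A y ->
  a *: A (c *: x + y) = c *: (a *: A x) + a *: A y.
Proof. by move=> Ax Ay; rewrite op_linear // scalerDr !scalerA mulrC. Qed.

Definition op_scale (a : K) A : operator H :=
  Operator (op_dom_subspace A) (@scale_linear a A).

Lemma zero_dom_subspace : linear_subspace [set: H].
Proof. by []. Qed.

Lemma zero_linear (c : K) (x y : H) : [set: H] x -> [set: H] y ->
  0 = c *: 0 + 0 :> H.
Proof. by rewrite scaler0 addr0. Qed.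

Definition op_zero : operator H :=
  Operator (op_fun := fun=> 0) zero_dom_subspace zero_linear.

Definition op_commutator A B : operator H := op_sub (op_comp A B) (op_comp B A).

Definition op_eq_on (D : set H) A B : Prop :=
  [/\ D `<=` op_dom A, D `<=` op_dom B & forall x : H, D x -> A x = B x].

Definition op_maps A (x y : H) : Prop := op_dom A x /\ A x = y.

End Operators.

Section SphericalPendulum.
Variables (R : realType) (H : completeNormedModType R[i]).

Definition norm_from_dot (dot : {dot H for Num.conj}) : Prop :=
  forall x : H, `|x| ^+ 2 = dot x x.

Definition orthonormal_basis (I : eqType) (dot : {dot H for Num.conj})
    (e : I -> H) : Prop :=
  (forall p q : I, dot (e p) (e q) = (p == q)%:R) /\
  closure (linear_span (range e)) = [set: H].

(* In families indexed by 'I_2, the indices 0 and 1 stand for the usual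
   subscripts 1 and 2. *)
Definition quantized_actions (hbar : R) (sigma : nat * int -> H)
    (Q : 'I_2 -> operator H) : Prop :=
  forall (n : nat) (m : int),
    op_maps (Q 0) (sigma (n, m)) ((n%:R * hbar)%:C *: sigma (n, m)) /\
    op_maps (Q 1) (sigma (n, m)) ((m%:~R * hbar)%:C *: sigma (n, m)).

Definition shifting_operators (sigma : nat * int -> H)
    (a : 'I_2 -> operator H) : Prop :=
  [/\ forall (n : nat) (m : int),
        op_maps (a 0) (sigma (n.+1, m)) (sigma (n, m)),
      forall m : int, op_maps (a 0) (sigma (0%N, m)) 0
    & forall (n : nat) (m : int),
        op_maps (a 1) (sigma (n, m)) (sigma (n, m - 1))].

End SphericalPendulum.

(* Main.v *)
(* Every vector sigma_(n,m) is a joint eigenvector of the actions, and a_k maps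
   it to a joint eigenvector (possibly 0) whose k-th eigenvalue is lowered by
   hbar; if A x = l x and A (B x) = mu (B x), then [A, B] x = (mu - l) B x. *)
Require Import Defs.
From HB Require Import structures.
From mathcomp Require Import all_boot all_order all_algebra.
From mathcomp Require Import all_classical all_reals all_analysis.

Import Order.TTheory GRing.Theory Num.Theory.
Import numFieldNormedType.Exports.

Local Open Scope classical_set_scope.
Local Open Scope ring_scope.
Local Open Scope complex_scope.

Section OperatorsOnSpan.
Set Implicit Arguments.
Unset Strict Implicit.
Variables (K : comPzRingType) (H : lmodType K).
Implicit Types A B : operator H.

(** The vectors lying in both domains on which [A] and [B] agree form a linear subspace. By
    minimality the span lies inside it once every [e i] does; the common image [y] carries both
    domain memberships and the equality. *)
Lemma linear_span_op_eq_on I (e : I -> H) A B :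
  (forall i, exists2 y, op_maps A (e i) y & op_maps B (e i) y) ->
  op_eq_on (linear_span (range e)) A B.
Proof.
move=> AB.
suff sub : linear_span (range e) `<=`
    [set x | [/\ op_dom A x, op_dom B x & A x = B x]].
  by split=> x /sub[].
apply: smallest_sub => [|_ [i _ <-]]; last first.
  by have [y [Ai <-] [Bi BA]] := AB i; split.
have [A0 AD] := op_dom_subspace A; have [B0 BD] := op_dom_subspace B.
split=> [|c x y [Ax Bx ABx] [Ay By ABy]]; first by split; rewrite ?op0.
by split; [exact: AD | exact: BD | rewrite !op_linear// ABx ABy].
Qed.

Lemma op_maps0 A : op_maps A 0 0.
Proof. by split; [exact: (op_dom_subspace A).1 | exact: op0]. Qed.

Lemma op_mapsZ A (c : K) (x y : H) : op_maps A x y -> op_maps A (c *: x) (c *: y).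
Proof.
have [A0 AD] := op_dom_subspace A; move=> [Ax <-]; split.
  by rewrite -[_ *: _]addr0; apply: AD.
by rewrite -[_ *: x]addr0 op_linear// op0 addr0.
Qed.

Lemma op_maps_commutator A B (x y y' z z' : H) :
  op_maps B x y -> op_maps A y z -> op_maps A x y' -> op_maps B y' z' ->
  op_maps (op_commutator A B) x (z - z').
Proof. by case=> Bx <- [ABx <-] [Ax <-] [BAx <-]. Qed.

Lemma op_maps_commutator_eigen A B (l mu : K) (x y : H) :
  op_maps A x (l *: x) -> op_maps B x y -> op_maps A y (mu *: y) ->
  op_maps (op_commutator A B) x ((mu - l) *: y).
Proof.
move=> Ax Bx Ay; rewrite scalerBl.
exact: op_maps_commutator Bx Ay Ax (op_mapsZ l Bx).
Qed.

End OperatorsOnSpan.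

(** Case analysis phrased with the constants [0] and [1] of ['I_2], the form in which the hypotheses
    on [Q] and [a] are stated. *)
Lemma ord2_ind (P : 'I_2 -> Prop) : P 0 -> P 1 -> forall j, P j.
Proof.
move=> P0 P1 [[|[|//]] lt_j2].
- by rewrite (_ : Ordinal _ = 0)//; exact: val_inj.
- by rewrite (_ : Ordinal _ = 1)//; exact: val_inj.
Qed.

Section Actions.
Set Implicit Arguments.
Unset Strict Implicit.
Variables (R : realType) (H : completeNormedModType R[i]).
Variables (sigma : nat * int -> H) (hbar : R) (Q a : 'I_2 -> operator H).
Hypothesis HQ : quantized_actions hbar sigma Q.
Hypothesis Ha : shifting_operators sigma a.

Definition action_value (j : 'I_2) (p : nat * int) : R[i] :=
  ((if j == 0 then p.1%:R else p.2%:~R) * hbar)%:C.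

Lemma quantized_action_eigen j p :
  op_maps (Q j) (sigma p) (action_value j p *: sigma p).
Proof. by case: p => n m; have [Q0 Q1] := HQ n m; elim/ord2_ind: j. Qed.

(* For a_1 sigma_(0,m) = 0 the lowered eigenvalue - hbar is attached to the zero
   vector, so no case distinction is needed in the conclusion. *)
Lemma shifting_operator_lowers k p : exists2 y, op_maps (a k) (sigma p) y &
  forall j, op_maps (Q j) y ((action_value j p - hbar%:C * (j == k)%:R) *: y).
Proof.
have [aS a0 a1] := Ha; case: p => n m; elim/ord2_ind: k.
- case: n => [|n].
    by exists 0 => // j; rewrite scaler0; exact: op_maps0.
  exists (sigma (n, m)) => // j.
  (* The lowered value is the eigenvalue at the shifted index: for [j = 0] one [hbar] is removed,
     and for [j = 1] neither the second index nor the value changes. *)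
  suff -> : action_value j (n.+1, m) - hbar%:C * (j == 0)%:R =
            action_value j (n, m) by exact: quantized_action_eigen.
  elim/ord2_ind: j; rewrite /action_value /= ?mulr0 ?subr0//.
  by rewrite mulr1 -rmorphB/= -natr1 mulrDl mul1r addrK.
- exists (sigma (n, m - 1)) => // j.
  suff -> : action_value j (n, m) - hbar%:C * (j == 1)%:R =
            action_value j (n, m - 1) by exact: quantized_action_eigen.
  elim/ord2_ind: j; rewrite /action_value /= ?mulr0 ?subr0//.
  by rewrite mulr1 -rmorphB/= intrB mulrBl mul1r.
Qed.

(** Both orders of application lead from [sigma p] to the same vector [z], through the intermediate
    images [y] and [y']. The case splits on [n] record where [a 0] reaches the boundary and gives
    0. *)
Lemma shifting_operators_commute j k p :
  op_maps (op_commutator (a j) (a k)) (sigma p) 0.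
Proof.
have [aS a0 a1] := Ha.
suff [y [y' [z [aky ajz ajy' akz]]]] : exists y y' z,
    [/\ op_maps (a k) (sigma p) y, op_maps (a j) y z,
        op_maps (a j) (sigma p) y' & op_maps (a k) y' z].
  by rewrite -(subrr z); exact: op_maps_commutator aky ajz ajy' akz.
case: p => n m; elim/ord2_ind: j; elim/ord2_ind: k.
(* Two applications of [a 0] can vanish at the first shift ([n = 0]) or at the second ([n = 1]). *)
- case: n => [|[|n]].
  + by exists 0, 0, 0; split=> //; exact: op_maps0.
  + by exists (sigma (0%N, m)), (sigma (0%N, m)), 0.
  + by exists (sigma (n.+1, m)), (sigma (n.+1, m)), (sigma (n, m)).
- case: n => [|n].
  + by exists (sigma (0%N, m - 1)), 0, 0; split=> //; exact: op_maps0.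
  + by exists (sigma (n.+1, m - 1)), (sigma (n, m)), (sigma (n, m - 1)).
- case: n => [|n].
  + by exists 0, (sigma (0%N, m - 1)), 0; split=> //; exact: op_maps0.
  + by exists (sigma (n, m)), (sigma (n.+1, m - 1)), (sigma (n, m - 1)).
- by exists (sigma (n, m - 1)), (sigma (n, m - 1)), (sigma (n, m - 1 - 1)).
Qed.

End Actions.

Theorem proposition3p6 (R : realType) (H : completeNormedModType R[i])
    (dot : {dot H for Num.conj}) (Hdot : norm_from_dot dot)
    (sigma : nat * int -> H) (Hsigma : orthonormal_basis dot sigma)
    (hbar : R) (Hhbar : 0 < hbar)
    (Q a : 'I_2 -> operator H)
    (HQ : quantized_actions hbar sigma Q)
    (Ha : shifting_operators sigma a) :
  forall j k : 'I_2,
    [/\ op_eq_on (linear_span (range sigma))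
          (op_commutator (Q j) (Q k)) (op_zero H),
        op_eq_on (linear_span (range sigma))
          (op_commutator (a j) (a k)) (op_zero H)
      & op_eq_on (linear_span (range sigma))
          (op_commutator (Q j) (a k))
          (op_scale (- hbar%:C * (j == k)%:R) (a j))].
Proof.
move=> j k; split; apply: linear_span_op_eq_on => p.
- exists 0 => //.
  have Qe := quantized_action_eigen HQ.
  (* The target 0 is put in the form [(mu - l) *: y] with [mu = l]: [Q k] only rescales [sigma p],
     so the eigenvalue of [Q j] is unchanged. *)
  rewrite -(scale0r (action_value hbar k p *: sigma p)).
  rewrite -(subrr (action_value hbar j p)).
  apply: (op_maps_commutator_eigen (Qe j p) (Qe k p)).
  rewrite scalerA mulrC -scalerA.
  exact/op_mapsZ/Qe.
- by exists 0 => //; exact: shifting_operators_commute.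
- have [y aky Qy] := shifting_operator_lowers HQ Ha k p.
  have := op_maps_commutator_eigen (quantized_action_eigen HQ j p) aky (Qy j).
  rewrite addrAC subrr add0r -mulNr => comm.
  exists ((- hbar%:C * (j == k)%:R) *: y) => //.
  (* The right-hand side involves [a j], whereas [y] is the image under [a k]; for [j = k] these
     coincide. *)
  have [jk|_] := eqVneq j k.
    by move: aky; rewrite -jk => -[ajp <-].
  (* For distinct indices both sides are 0, but [sigma p] must still be shown to lie in the domain
     of [a j]. *)
  have [y' [ajp _] _] := shifting_operator_lowers HQ Ha j p.
  by split=> //=; rewrite mulr0 !scale0r.
Qed.
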